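(* Let $\Pi_1$ and $\Pi_2$ be optimal control problems, $\Pi_i=(X_i,U_i,F_i,G_i,g_i)$. Suppose that $Q\colon X_1\rightrightarrows X_2$ is a valuated feedback refinement relation from $\Pi_1$ to $\Pi_2$ and that $C\in\mathcal{F}(X_2,U_2)$. Then $C\circ Q\in\mathcal{F}(X_1,U_1)$ and $$L_1(p_1)\le\sup L_2(Q(p_1))\quad\text{for all }p_1\in X_1,$$ where $L_1$ and $L_2$ are the closed-loop value functions of $\Pi_1$ and $\Pi_2$ associated with $C\circ Q$ and $C$, respectively.
   Context: Conventions: $\mathbb{R}_+=[0,\infty)$, $\mathbb{Z}_+=\{0,1,2,\dots\}$; $\infty+x=\infty$ for $x\in\mathbb{R}$; $\sup\emptyset=0$; $A^B$ is the set of maps $B\to A$. A set-valued map $f\colon A\rightrightarrows B$ assigns to each $a\in A$ a subset $f(a)\subseteq B$ and is identified with the relation $\{(a,b): b\in f(a)\}$; it is strict if $f(a)\neq\emptyset$ for all $a$; $f(C)=\bigcup_{a\in C}f(a)$. System: a triple $(X,U,F)$ with nonempty sets $X,U$ and strict $F\colon X\times U\rightrightarrows X$. A pair $(u,x)\in U^{\mathbb{Z}_+}\times X^{\mathbb{Z}_+}$ is a solution of it if $x(t+1)\in F(x(t),u(t))$ for all $t\in\mathbb{Z}_+$. Controller for $(X,U,F)$: a quintuple $C=(Z,Z_0,\widetilde X,\widetilde U,H)$ of nonempty sets $Z,Z_0,\widetilde X,\widetilde U$ with $Z_0\subseteq Z$, $X\subseteq\widetilde X$, $\widetilde U\subseteq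 U$, and a strict map $H\colon Z\times\widetilde X\rightrightarrows Z\times\widetilde U\times\{0,1\}$. A quadruple $(u,v,z,x)\in\widetilde U^{\mathbb{Z}_+}\times\{0,1\}^{\mathbb{Z}_+}\times Z^{\mathbb{Z}_+}\times\widetilde X^{\mathbb{Z}_+}$ is a solution of $C$ if $z(0)\in Z_0$ and $(z(t+1),u(t),v(t))\in H(z(t),x(t))$ for all $t\in\mathbb{Z}_+$. $\mathcal{F}(X,U)$ denotes the collection of all controllers for $(X,U,F)$. Behavior: for a system $S=(X,U,F)$ and $C\in\mathcal{F}(X,U)$, $\mathcal{B}(C\times S)$ is the set of $(u,v,x)\in(U\times\{0,1\}\times X)^{\mathbb{Z}_+}$ for which there is $z\colon\mathbb{Z}_+\to Z$ such that $(u,v,z,x)$ is a solution of $C$ and $(u,x)$ is a solution of $S$; $\mathcal{B}_p(C\times S)=\{(u,v,x)\in\mathcal{B}(C\times S): x(0)=p\}$. Optimal control problem: a tuple $\Pi=(X,U,F,G,g)$ where $S=(X,U,F)$ is a system, $G\colon X\to\mathbb{R}_+\cup\{\infty\}$ (terminal cost) and $g\colon X\times X\times U\to\mathbb{R}_+\cup\{\infty\}$ (running cost). Its cost functional $J\colon(U\times\{0,1\}\times X)^{\mathbb{Z}_+}\to[0,\infty]$ is $J(u,v,x)=G(x(T))+\sum_{t=0}^{T-1}g(x(t),x(t+1),u(t))$ if $v\neq0$, where $T=\min v^{-1}(1)$, and $J(u,v,x)=\infty$ if $v=0$. The closed-loop value function of $\Pi$ associated with $C\in\mathcal{F}(X,U)$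 is $L(p)=\sup_{(u,v,x)\in\mathcal{B}_p(C\times S)}J(u,v,x)$, $p\in X$. Valuated feedback refinement relation from $\Pi_1$ to $\Pi_2$: a strict relation $Q\colon X_1\rightrightarrows X_2$ such that for all $(p_1,p_2),(q_1,q_2)\in Q$ and all $u\in U_2$: (i) $U_2\subseteq U_1$; (ii) $G_1(p_1)\le G_2(p_2)$; (iii) $g_1(p_1,q_1,u)\le g_2(p_2,q_2,u)$; (iv) $Q(F_1(p_1,u))\subseteq F_2(p_2,u)$. Serial composition: for a controller $C=(Z,Z_0,\widetilde X,\widetilde U,H)$, a nonempty set $X'$ and a strict map $Q\colon X'\rightrightarrows\widetilde X$, $C\circ Q$ is the controller $(Z,Z_0,X',\widetilde U,H')$ with $H'(z,x')=H(z,Q(x'))=\bigcup_{y\in Q(x')}H(z,y)$. (Here $Q\colon X_1\rightrightarrows X_2$ is regarded as a map into the input alphabet $\widetilde X\supseteq X_2$ of $C$.) *)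

(* Defs.v *)
From mathcomp Require Import all_boot all_order all_algebra.
From mathcomp Require Import all_classical all_reals all_analysis.

Set Implicit Arguments.
Unset Strict Implicit.
Unset Printing Implicit Defensive.

Import Order.TTheory GRing.Theory Num.Theory.

Local Open Scope classical_set_scope.
Local Open Scope ring_scope.
Local Open Scope ereal_scope.

(* Alphabets are subsets of ambient types, so that inclusions between them
   (of X in the input alphabet of a controller, of U2 in U1, ...) are literal.
   A map defined on a subset is represented by a function on the ambient type;
   its values outside the subset are irrelevant.  The records carry the data
   only; the axioms are in the accompanying predicates. *)

Definition strict_map (A B : Type) (D : set A) (E : set B) (f : A -> set B) :=
  forall a, D a -> f a `<=` E /\ f a !=set0.

Definition image_map (A B : Type) (f : A -> set B) (D : set A) : set B :=
  \bigcup_(a in D) f a.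

Record system (TX TU : Type) := System {
  states : set TX;
  inputs : set TU;
  trans : TX * TU -> set TX
}.

Definition is_system (TX TU : Type) (S : system TX TU) : Prop :=
  [/\ states S !=set0, inputs S !=set0 &
      strict_map (states S `*` inputs S) (states S) (trans S)].

Definition sys_solution (TX TU : Type) (S : system TX TU)
    (u : nat -> TU) (x : nat -> TX) : Prop :=
  [/\ (forall t, inputs S (u t)), (forall t, states S (x t)) &
      (forall t, trans S (x t, u t) (x t.+1))].

(* {0,1} is bool, with 1 = true. *)
Record controller (TZ TX TU : Type) := Controller {
  cstates : set TZ;
  cinit : set TZ;
  cin : set TX;
  cout : set TU;
  ctrans : TZ * TX -> set (TZ * TU * bool)
}.

(* C belongs to F(X, U) *)
Definition is_controller (TZ TX TU : Type) (X : set TX) (U : set TU)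
    (C : controller TZ TX TU) : Prop :=
  [/\ [/\ cstates C !=set0, cinit C !=set0, cin C !=set0 & cout C !=set0],
      cinit C `<=` cstates C, X `<=` cin C, cout C `<=` U &
      strict_map (cstates C `*` cin C) (cstates C `*` cout C `*` [set: bool])
        (ctrans C)].

Definition ctrl_solution (TZ TX TU : Type) (C : controller TZ TX TU)
    (u : nat -> TU) (v : nat -> bool) (z : nat -> TZ) (x : nat -> TX) : Prop :=
  [/\ (forall t, cout C (u t)), (forall t, cstates C (z t)),
      (forall t, cin C (x t)), cinit C (z 0%N) &
      (forall t, ctrans C (z t, x t) (z t.+1, u t, v t))].

Definition behavior (TZ TX TU : Type) (C : controller TZ TX TU)
    (S : system TX TU) : set ((nat -> TU) * (nat -> bool) * (nat -> TX)) :=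
  [set w | exists z, ctrl_solution C w.1.1 w.1.2 z w.2 /\
                     sys_solution S w.1.1 w.2].

Definition behavior_from (TZ TX TU : Type) (C : controller TZ TX TU)
    (S : system TX TU) (p : TX) :
    set ((nat -> TU) * (nat -> bool) * (nat -> TX)) :=
  [set w | behavior C S w /\ w.2 0%N = p].

Record ocp (R : realType) (TX TU : Type) := Ocp {
  ocp_sys : system TX TU;
  terminal_cost : TX -> \bar R;
  running_cost : TX -> TX -> TU -> \bar R
}.

Definition is_ocp (R : realType) (TX TU : Type) (P : ocp R TX TU) : Prop :=
  [/\ is_system (ocp_sys P),
      (forall p, states (ocp_sys P) p -> 0 <= terminal_cost P p) &
      (forall p q u, states (ocp_sys P) p -> states (ocp_sys P) q ->
         inputs (ocp_sys P) u -> 0 <= running_cost P p q u)].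

Definition cost (R : realType) (TX TU : Type) (P : ocp R TX TU)
    (w : (nat -> TU) * (nat -> bool) * (nat -> TX)) : \bar R :=
  let: (u, v, x) := w in
  match pselect (exists t, v t) with
  | left stops => let T := ex_minn stops in
      terminal_cost P (x T) +
      \sum_(0 <= t < T) running_cost P (x t) (x t.+1) (u t)
  | right _ => +oo
  end.

(* Suprema are taken in [0, +oo], hence sup set0 = 0 (whereas ereal_sup set0 is
   -oo). *)
Definition sup_nneg (R : realType) (A : set (\bar R)) : \bar R := supremum 0 A.

Definition closed_loop_value (R : realType) (TZ TX TU : Type)
    (P : ocp R TX TU) (C : controller TZ TX TU) (p : TX) : \bar R :=
  sup_nneg (cost P @` behavior_from C (ocp_sys P) p).

Definition is_vfrr (R : realType) (TX1 TX2 TU : Type)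
    (P1 : ocp R TX1 TU) (P2 : ocp R TX2 TU) (Q : TX1 -> set TX2) : Prop :=
  let S1 := ocp_sys P1 in
  let S2 := ocp_sys P2 in
  strict_map (states S1) (states S2) Q /\
  inputs S2 `<=` inputs S1 /\
  forall p1 p2 q1 q2 u,
    states S1 p1 -> Q p1 p2 -> states S1 q1 -> Q q1 q2 -> inputs S2 u ->
    [/\ terminal_cost P1 p1 <= terminal_cost P2 p2,
        running_cost P1 p1 q1 u <= running_cost P2 p2 q2 u &
        image_map Q (trans S1 (p1, u)) `<=` trans S2 (p2, u)].

(* C o Q, for a map Q from X' to the input alphabet of C *)
Definition serial (TZ TX TX' TU : Type) (C : controller TZ TX TU)
    (X' : set TX') (Q : TX' -> set TX) : controller TZ TX' TU :=
  {| cstates := cstates C;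
     cinit := cinit C;
     cin := X';
     cout := cout C;
     ctrans := fun zx => \bigcup_(y in Q zx.2) ctrans C (zx.1, y) |}.

(* Main.v *)
Require Import Defs.
From mathcomp Require Import all_boot all_order all_algebra.
From mathcomp Require Import all_classical all_reals all_analysis.
Set Implicit Arguments.
Unset Strict Implicit.
Unset Printing Implicit Defensive.
Import Order.TTheory.
Local Open Scope classical_set_scope.
Local Open Scope ereal_scope.

(** A run of the closed loop of [serial C X1 Q] with the first system hides a
    run of the closed loop of [C] with the second one: at each time the composed
    controller moves as [C] does on some [y t] in [Q (x t)].  The sequence [y]
    is a trajectory of the second system under the same inputs, since
    [y t.+1] lies in [Q (F1 (x t, u t))], hence in [F2 (y t, u t)]
    ([behavior_serial]).  Both runs stop at the same time, as they share [v], so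
    the cost inequalities along [Q] add up ([cost_vfrr]): every cost counted in
    the value function at [p1] is bounded by a cost counted at the point [y 0]
    of [Q p1].

    As suprema are taken in the nonnegative extended reals, with value 0 on the
    empty set, comparing them also takes the nonnegativity of the costs of
    actual runs ([cost_ge0]). *)

Section SupNneg.
Variable R : realType.
Implicit Types (A : set (\bar R)) (b x : \bar R).

(** The supremum over the empty set is the only one where the default value 0
    shows. *)
Lemma sup_nnegE A : A !=set0 -> sup_nneg A = ereal_sup A.
Proof.
move=> A0; have nA : A <> set0 by apply/eqP/set0P.
rewrite /ereal_sup /sup_nneg /supremum; case: ifPn => [/eqP//|_].
(* The default value of [xget] is immaterial on a singleton of least upper
   bounds. *)
have [s As] := ereal_supremums_neq0 A.
by rewrite !(xget_subset1 _ As)//; exact: is_subset1_supremums.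
Qed.

Lemma sup_nneg_ubound A x : A x -> x <= sup_nneg A.
Proof. by move=> Ax; rewrite sup_nnegE; [exact: ereal_sup_ubound|exists x]. Qed.

Lemma sup_nneg_le A b : 0 <= b -> ubound A b -> sup_nneg A <= b.
Proof.
move=> b0 Ab; have [->|/set0P A0] := eqVneq A set0.
  by rewrite /sup_nneg supremum0.
by rewrite sup_nnegE//; exact: ge_ereal_sup.
Qed.

Lemma sup_nneg_ge0 A : lbound A 0 -> 0 <= sup_nneg A.
Proof.
move=> A0; have [->|/set0P[x Ax]] := eqVneq A set0.
  by rewrite /sup_nneg supremum0.
exact: le_trans (A0 _ Ax) (sup_nneg_ubound Ax).
Qed.

End SupNneg.

Lemma is_controller_serial (TX1 TX2 TU TZ : Type) (X1 : set TX1) (X2 : set TX2)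
    (U1 U2 : set TU) (Q : TX1 -> set TX2) (C : controller TZ TX2 TU) :
  X1 !=set0 -> U2 `<=` U1 -> strict_map X1 X2 Q -> is_controller X2 U2 C ->
  is_controller X1 U1 (serial C X1 Q).
Proof.
move=> X1n sU hQ [[Zn Z0n _ Un] sZ sX sUC hH]; split => //=.
  exact: subset_trans sUC sU.
move=> [z x] /= [Zz Xx]; have [QX [y Qxy]] := hQ _ Xx.
have H y' : Q x y' -> _ := fun Qy' => hH (z, y') (conj Zz (sX _ (QX _ Qy'))).
split; first by apply: bigcup_sub => y' /H[].
by have [_ [w Hw]] := H _ Qxy; exists w, y.
Qed.

(** The sequence [y] picks the elements of [Q (x t)] that witness the
    transitions of the composed controller. *)
Lemma behavior_serial (R : realType) (TX1 TX2 TU TZ : Type)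
    (P1 : ocp R TX1 TU) (P2 : ocp R TX2 TU) (Q : TX1 -> set TX2)
    (C : controller TZ TX2 TU) u v x :
  is_vfrr P1 P2 Q ->
  is_controller (states (ocp_sys P2)) (inputs (ocp_sys P2)) C ->
  behavior (serial C (states (ocp_sys P1)) Q) (ocp_sys P1) (u, v, x) ->
  exists2 y, (forall t, Q (x t) (y t)) & behavior C (ocp_sys P2) (u, v, y).
Proof.
move=> [hQ [_ hF]] [_ _ sX sU _] [z /= [[Uu Zz X1x Z0z Hz] [_ _ Fx]]].
have /choice[y Hy] t : exists y, Q (x t) y /\
    ctrans C (z t, y) (z t.+1, u t, v t).
  by have [y ? ?] := Hz t; exists y.
have Qy t : Q (x t) (y t) by have [] := Hy t.
have X2y t : states (ocp_sys P2) (y t) by have [QX _] := hQ _ (X1x t); exact: QX.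
have U2u t : inputs (ocp_sys P2) (u t) by exact/sU/Uu.
exists y => //; exists z; split; split => //= t.
- exact: sX.
- exact: (Hy t).2.
- have [_ _] := hF _ _ _ _ _ (X1x t) (Qy t) (X1x t) (Qy t) (U2u t).
  by apply; exists (x t.+1).
Qed.

Lemma cost_ge0 (R : realType) (TX TU TZ : Type) (P : ocp R TX TU)
    (C : controller TZ TX TU) w :
  is_ocp P -> behavior C (ocp_sys P) w -> 0 <= cost P w.
Proof.
move: w => [[u v] x] [_ G0 g0] [z [_ [/= Uu Xx _]]].
rewrite /cost; case: pselect => [stops|_]; last exact: leey.
by apply: adde_ge0; [exact: G0|apply: sume_ge0 => t _; exact: g0].
Qed.

Lemma cost_vfrr (R : realType) (TX1 TX2 TU : Type)
    (P1 : ocp R TX1 TU) (P2 : ocp R TX2 TU) (Q : TX1 -> set TX2) u v x y :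
  is_vfrr P1 P2 Q -> (forall t, inputs (ocp_sys P2) (u t)) ->
  (forall t, states (ocp_sys P1) (x t)) -> (forall t, Q (x t) (y t)) ->
  cost P1 (u, v, x) <= cost P2 (u, v, y).
Proof.
move=> [_ [_ h]] Uu Xx Qxy.
have {}h s t := h _ _ _ _ _ (Xx s) (Qxy s) (Xx t) (Qxy t) (Uu s).
rewrite /cost; case: pselect => // stops.
apply: leeD; first by have [] := h (ex_minn stops) 0%N.
by apply: lee_sum => t _; have [] := h t t.+1.
Qed.

Lemma closed_loop_value_ge0 (R : realType) (TX TU TZ : Type) (P : ocp R TX TU)
    (C : controller TZ TX TU) p :
  is_ocp P -> 0 <= closed_loop_value P C p.
Proof.
by move=> hP; apply: sup_nneg_ge0 => _ [w [Bw _] <-]; exact: cost_ge0 Bw.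
Qed.

Theorem theoremV6 (R : realType) (TX1 TX2 TU TZ : Type)
    (P1 : ocp R TX1 TU) (P2 : ocp R TX2 TU)
    (Q : TX1 -> set TX2) (C : controller TZ TX2 TU)
    (hP1 : is_ocp P1) (hP2 : is_ocp P2) (hQ : is_vfrr P1 P2 Q)
    (hC : is_controller (states (ocp_sys P2)) (inputs (ocp_sys P2)) C) :
  let CQ := serial C (states (ocp_sys P1)) Q in
  is_controller (states (ocp_sys P1)) (inputs (ocp_sys P1)) CQ /\
  forall p1, states (ocp_sys P1) p1 ->
    closed_loop_value P1 CQ p1 <= sup_nneg (closed_loop_value P2 C @` Q p1).
Proof.
move=> CQ; split.
  have [[X1n _ _] _ _] := hP1; have [sQ [sU _]] := hQ.
  exact: is_controller_serial hC.
move=> p1 _; apply: sup_nneg_le.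
  by apply: sup_nneg_ge0 => _ [p2 _ <-]; exact: closed_loop_value_ge0.
move=> _ [[[u v] x] [Bx /= x0] <-].
have [y Qxy By] := behavior_serial hQ hC Bx.
have [_ [_ [/= _ X1x _]]] := Bx; have [_ [_ [/= U2u _ _]]] := By.
apply: (le_trans (cost_vfrr v hQ U2u X1x Qxy)).
apply: (@le_trans _ _ (closed_loop_value P2 C (y 0%N))).
  by apply: sup_nneg_ubound; exists (u, v, y).
by apply: sup_nneg_ubound; exists (y 0%N) => //; rewrite -x0; exact: Qxy.
Qed.
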